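(* For any integer $e \ge 4$, we have $\omega_e > e+2$, and moreover, for every integer $n \ge b_e$: (i) if $b_e \le n < \omega_e$, then $\rho(\mathcal{D}_{n,e}) < \psi_e$; (ii) if $n = \omega_e$, then $\rho(\mathcal{D}_{n,e}) = \psi_e$; (iii) if $n > \omega_e$, then $\rho(\mathcal{D}_{n,e}) > \psi_e$.
   Context: All graphs are undirected, finite and simple. The spectral radius $\rho(G)$ of a graph $G$ is the largest modulus of an eigenvalue of its adjacency matrix. $G_1 \lor G_2$ and $G_1 + G_2$ denote the join and the disjoint union of graphs; $K_0$ (and $0K_1$) is the empty graph on no vertices, which is neutral for both operations. For an integer $e \ge 1$, let $k_e$ be the largest natural number with $\binom{k_e}{2} \le e$, and let $t_e = e - \binom{k_e}{2}$ (so $0 \le t_e \le k_e - 1$). Let $b_e = k_e + 1$ if $t_e = 0$, and $b_e = k_e + 2$ if $t_e \ne 0$. For $n \ge b_e$, the graph $\mathcal{D}_{n,e}$ (connected, with $n$ vertices and $n-1+e$ edges) is $$\mathcal{D}_{n,e} = \big( ( (K_{k_e - t_e} + K_1) \lor K_{t_e} ) + (n - k_e - 2) K_1 \big) \lor K_1 \quad \text{if } n \ge k_e + 2, \qquad \mathcal{D}_{n,e} = K_n \quad \text{if } n < k_e + 2.$$ For $e \ge 4$, writing $k = k_e$, $t = t_e$, define the polynomial \begin{align*} \Psi_e(\lambda) &= \lambda^3 (k-1)(k-2)(k^2-3k+4t)\\ &\quad - \lambda^2 \big(k^5 - 6k^4 + k^3(4t+15) - k^2(20t+18) + k(8t^2+24t+8)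 - (4t^2+12t)\big)\\ &\quad - \lambda (k^2-k+2t)\big(k^3 + k^2(t-4) - k(3t-5) + (4t^2-2t-2)\big)\\ &\quad + t(k-t-1)(k^2-3k+2t)(k^2-k+2t), \end{align*} let $\psi_e$ be the largest real root of $\Psi_e$ (it exists), and let $$\omega_e = e + 2 + \frac{\psi_e(\psi_e+1)(\psi_e^2-\psi_e-2e)}{\psi_e^2-e}.$$ *)

(* Defs.v *)
From mathcomp Require Import all_boot all_order all_algebra.
From mathcomp Require Import all_classical all_reals.
From mathcomp Require Import complex polyrcf.
From mathcomp Require Import ring lra zify.

Set Implicit Arguments.
Unset Strict Implicit.
Unset Printing Implicit Defensive.

Import Order.TTheory GRing.Theory Num.Theory.

Local Open Scope ring_scope.

Record sgraph := SGraph {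
  vertex :> finType;
  adj : rel vertex;
  adj_sym : symmetric adj;
  adj_irr : irreflexive adj }.

Section GraphOps.
Local Open Scope nat_scope.

Lemma complete_sym n : symmetric [rel i j : 'I_n | i != j].
Proof. by move=> i j; rewrite /= eq_sym. Qed.

Lemma complete_irr n : irreflexive [rel i j : 'I_n | i != j].
Proof. by move=> i; rewrite /= eqxx. Qed.

Definition complete (n : nat) : sgraph :=
  SGraph (@complete_sym n) (@complete_irr n).

Lemma edgeless_sym n : symmetric [rel _ _ : 'I_n | false].
Proof. by []. Qed.

Lemma edgeless_irr n : irreflexive [rel _ _ : 'I_n | false].
Proof. by []. Qed.

(* [edgeless n] is $nK_1$. *)
Definition edgeless (n : nat) : sgraph :=
  SGraph (@edgeless_sym n) (@edgeless_irr n).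

(* Disjoint union ([cross = false]) or join ([cross = true]); [cross] says
   whether vertices of different summands are adjacent. *)
Definition sum_adj (cross : bool) (G H : sgraph) : rel (G + H)%type :=
  fun x y => match x, y with
             | inl u, inl v => adj u v
             | inr u, inr v => adj u v
             | _, _ => cross
             end.

Lemma sum_adj_sym b G H : symmetric (@sum_adj b G H).
Proof. by case=> x; case=> y //=; apply: adj_sym. Qed.

Lemma sum_adj_irr b G H : irreflexive (@sum_adj b G H).
Proof. by case=> x /=; apply: adj_irr. Qed.

Definition gunion (G H : sgraph) : sgraph :=
  SGraph (@sum_adj_sym false G H) (@sum_adj_irr false G H).

Definition gjoin (G H : sgraph) : sgraph :=
  SGraph (@sum_adj_sym true G H) (@sum_adj_irr true G H).

End GraphOps.

Section Largest.
Variable R : realType.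
Implicit Types (A : set R) (x : R).

(* [largest A] is 0 if [A] has no largest element; see [spectral_radiusP] and
   [psiP] for the two sets it is used on. *)
Definition largest A : R := xget 0 [set x | A x /\ ubound A x]%classic.

Lemma largestE A x : A x -> ubound A x -> largest A = x.
Proof.
move=> Ax ubx; rewrite /largest.
have [|Ag ubg] := @xgetPex R 0 [set x | A x /\ ubound A x]%classic.
  by exists x.
by apply/le_anti/andP; split; [exact: ubx | exact: ubg].
Qed.

Lemma largest_seq A (s : seq R) (x0 : R) :
  A x0 -> (forall x, A x -> x \in s) ->
  A (largest A) /\ ubound A (largest A).
Proof.
move=> Ax0 As; apply: (@xgetPex R 0 [set x | A x /\ ubound A x]%classic).
elim: s A x0 Ax0 As => [|a s IHs] A x0 Ax0 As; first by have := As _ Ax0.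
have [[x1 [Ax1 x1a]]|none] := pselect (exists x, A x /\ x != a); last first.
  have eqa x : A x -> x = a.
    by move=> Ax; have [//|xa] := eqVneq x a; case: none; exists x.
  by exists x0; split=> // y Ay; rewrite (eqa _ Ay) (eqa _ Ax0).
have [||m [[Am ma] ubm]] := IHs (fun x : R => A x /\ x != a) x1.
- by split.
- by move=> x [Ax xa]; have := As _ Ax; rewrite inE (negPf xa).
have ub y : A y -> y != a -> y <= m by move=> Ay ya; apply: ubm; split.
have [Aa|nAa] := pselect (A a); last first.
  exists m; split=> // y Ay; apply: ub => //.
  by apply/eqP => ya; apply: nAa; rewrite -ya.
have [am|/ltW ma'] := leP a m.
  exists m; split=> // y Ay; have [->//|ya] := eqVneq y a; exact: ub.
exists a; split=> // y Ay; have [->//|ya] := eqVneq y a.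
exact: le_trans (ub _ Ay ya) ma'.
Qed.

End Largest.

Definition adjmx (F : pzSemiRingType) (G : sgraph) : 'M[F]_#|G| :=
  \matrix_(i, j) (adj (enum_val i) (enum_val j))%:R.

Section SpectralRadius.
Variable R : realType.
Implicit Types G : sgraph.

Definition eigen_moduli G : set R :=
  [set ComplexField.Normc.normc z | z in [set z : R[i] | eigenvalue (adjmx _ G) z]]%classic.

Definition spectral_radius G : R := largest (eigen_moduli G).

Lemma spectral_radiusP G : (0 < #|G|)%N ->
  eigen_moduli G (spectral_radius G) /\
  ubound (eigen_moduli G) (spectral_radius G).
Proof.
move=> G0; pose p := char_poly (adjmx R[i] G).
have [s ps] := closed_field_poly_normal p.
have [|z z0] := closed_rootP p _.
  by rewrite size_char_poly eqSS -lt0n.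
apply: (@largest_seq _ _ (map (@ComplexField.Normc.normc R) s) (ComplexField.Normc.normc z)).
  by exists z => //=; rewrite eigenvalue_root_char.
move=> _ [w + <-]; rewrite /= eigenvalue_root_char -/p => pw.
apply/map_f; move: pw; rewrite ps rootZ ?root_prod_XsubC//.
by rewrite lead_coef_eq0 monic_neq0 // char_poly_monic.
Qed.

End SpectralRadius.

Section DGraph.
Local Open Scope nat_scope.

Lemma k_ex e : exists k, 'C(k, 2) <= e.
Proof. by exists 0. Qed.

Lemma k_bound e k : 'C(k, 2) <= e -> k <= e.+1.
Proof.
case: k => // k; rewrite binS bin1 => h.
exact: leq_trans (leq_addl _ _) h.
Qed.

Definition k_ (e : nat) : nat := ex_maxn (k_ex e) (@k_bound e).

Definition t_ (e : nat) : nat := e - 'C(k_ e, 2).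

Definition b_ (e : nat) : nat := if t_ e == 0 then k_ e + 1 else k_ e + 2.

Definition Dgraph (n e : nat) : sgraph :=
  let k := k_ e in let t := t_ e in
  if k + 2 <= n then
    gjoin (gunion (gjoin (gunion (complete (k - t)) (complete 1)) (complete t))
                  (edgeless (n - k - 2)))
          (complete 1)
  else complete n.

End DGraph.

Section Omega.
Variables (R : realType) (e : nat).

Definition Psi : {poly R} :=
  let k : R := (k_ e)%:R in
  let t : R := (t_ e)%:R in
  ((k - 1) * (k - 2) * (k ^+ 2 - 3 * k + 4 * t)) *: 'X^3
  - (k ^+ 5 - 6 * k ^+ 4 + k ^+ 3 * (4 * t + 15) - k ^+ 2 * (20 * t + 18)
     + k * (8 * t ^+ 2 + 24 * t + 8) - (4 * t ^+ 2 + 12 * t)) *: 'X^2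
  - ((k ^+ 2 - k + 2 * t)
     * (k ^+ 3 + k ^+ 2 * (t - 4) - k * (3 * t - 5)
        + (4 * t ^+ 2 - 2 * t - 2))) *: 'X
  + (t * (k - t - 1) * (k ^+ 2 - 3 * k + 2 * t) * (k ^+ 2 - k + 2 * t))%:P.

Definition psi : R := largest [set x | root Psi x]%classic.

Lemma psiP : (4 <= e)%N ->
  root Psi psi /\ forall x, root Psi x -> x <= psi.
Proof.
move=> e4; pose k : R := (k_ e)%:R; pose t : R := (t_ e)%:R.
have [k3 kt] : (3 <= k_ e)%N /\ ((3 < k_ e) || (0 < t_ e))%N.
  rewrite /t_ /k_; case: ex_maxnP => i ie imax.
  have i3 : (3 <= i)%N by apply: imax; exact: leq_trans e4.
  split=> //; rewrite subn_gt0; move: i3; rewrite leq_eqVlt => /orP[/eqP<-|->//].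
  by rewrite e4 orbT.
have k3R : 3 <= k by rewrite /k ler_nat.
have t0R : 0 <= t by rewrite /t ler0n.
have lc0 : (k - 1) * (k - 2) * (k ^+ 2 - 3 * k + 4 * t) != 0.
  rewrite gt_eqF// !mulr_gt0//; try lra.
  case/orP: kt => [k4|t1].
    have k4R : 4 <= k by rewrite /k ler_nat.
    nra.
  have t1R : 1 <= t by rewrite /t ler1n.
  nra.
have sP : size Psi = 4.
  rewrite /Psi -/k -/t -addrA -addrA size_polyDl size_scale ?size_polyXn//.
  rewrite ltnS; apply: (leq_trans (size_polyD _ _)).
  rewrite geq_max size_polyN (leq_trans (size_scale_leq _ _)) ?size_polyXn//=.
  apply: (leq_trans (size_polyD _ _)).
  rewrite geq_max size_polyN (leq_trans (size_scale_leq _ _)) ?size_polyX//=.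
  exact: (leq_trans (size_polyC_leq1 _)).
have P0 : Psi != 0 by rewrite -size_poly_eq0 sP.
have [|x0 rx0] := @odd_poly_root R Psi; first by rewrite sP.
apply: (@largest_seq _ _ (rootsR Psi) x0 rx0) => x /= rx.
by rewrite -(roots_on_rootsR P0) rx andbT in_itv.
Qed.

Definition omega : R :=
  e%:R + 2 + psi * (psi + 1) * (psi ^+ 2 - psi - 2 * e%:R) / (psi ^+ 2 - e%:R).

End Omega.

(* Main.v *)
Require Import Defs.
From mathcomp Require Import all_boot all_order all_algebra.
From mathcomp Require Import all_classical all_reals.
From mathcomp Require Import complex polyrcf.
From mathcomp Require Import ring lra zify.

Set Implicit Arguments.
Unset Strict Implicit.
Unset Printing Implicit Defensive.

Import Order.TTheory GRing.Theory Num.Theory.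

Local Open Scope ring_scope.

(** Write [k], [t] for [k_ e], [t_ e] and [m = n - k - 2], and let [x >= k] be
    a candidate for the spectral radius of D.  The eigenvalue equations at all
    vertices but the apex (the vertex adjacent to all others) can be solved
    explicitly: up to scaling they force the vector [Dvec], which is positive
    for [x >= k].  The one equation that remains, at the apex, says that the
    quintic [defect k t m x] vanishes.  Because a positive vector compares the
    spectral radius with [x], the sign of the defect decides everything:
    - if it is positive, a slightly smaller weight at the apex gives a strict
      supersolution, and the spectral radius is below [x]
      ([spectral_radius_defect_gt0]);
    - if it vanishes, [Dvec] is a positive eigenvector and the spectral radius
      is [x] ([spectral_radius_defect_eq0]);
    - if it is negative, the quintic has a root beyond [x], and by the previous
      case this root is the spectral radius ([spectral_radius_defect_lt0]).

    It remains to take [x = psi].  Solving the apex equation for [n] gives a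
    rational function of [x]; doing the same for the quasi-star, the join of
    one vertex with a star with [e] edges and isolated vertices, gives the
    function whose value at [psi] is [omega].  The polynomial [Psi] is four
    times the numerator of the difference of the two functions
    ([Psi_defect]).  Hence at its root [psi] the defect is
    [omega - n] times a positive factor ([defect_omega]).

    All this needs [psi > k].  Let [x0] be the positive root of
    [x ^+ 2 - x = 2 * e]; it is at least [k].  There the quasi-star term of
    [Psi_defect] vanishes and [Psi] is negative ([Psi_lt0]), whereas the
    leading coefficient of [Psi] is positive, so the largest root exceeds
    [x0] ([psi_gt]).  The inequality [psi > x0] also makes the fraction in the
    definition of [omega] positive, which is the bound [omega > e + 2]. *)

(** * Weighted neighbour sums and the spectral radius *)

Definition nbsum (R : pzSemiRingType) (G : sgraph) (f : G -> R) (x : G) : R :=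
  \sum_(y : G) (adj x y)%:R * f y.

Lemma nbsum_enum (R : pzSemiRingType) (G : sgraph) (f : G -> R) (i : 'I_#|G|) :
  nbsum f (enum_val i) = \sum_j adjmx R G j i * f (enum_val j).
Proof.
rewrite /nbsum (reindex _ (onW_bij _ (@enum_val_bij G))) /=.
by apply: eq_bigr => j _; rewrite mxE adj_sym.
Qed.

(** At the index where the ratio of the modulus of an eigenvector to [f] is
    largest, the eigenvalue equation bounds the modulus of the eigenvalue by
    the value of [nbsum f / f] there. *)
Lemma spectral_radius_lt (R : realType) (G : sgraph) (f : G -> R) (r : R) :
  (0 < #|G|)%N -> (forall x, 0 < f x) -> (forall x, nbsum f x < r * f x) ->
  spectral_radius R G < r.
Proof.
move=> G0 f0 fr; have [[z /eigenvalueP[y yz y0] <-] _] := spectral_radiusP R G0.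
pose nc := @ComplexField.Normc.normc R.
have nc0 w : 0 <= nc w by rewrite /nc; case: w => a b; rewrite sqrtr_ge0.
pose w i := nc (y 0 i) / f (enum_val i).
have [i _ imax] := @arg_maxP _ _ _ (Ordinal G0) xpredT w isT.
have wi0 : 0 < w i.
  have [j yj] : exists j, y 0 j != 0 by apply/rV0Pn.
  apply: lt_le_trans (imax j isT).
  rewrite divr_gt0// lt_def nc0 andbT.
  by apply: contraNneq yj => /ComplexField.Normc.eq0_normc ->.
have yE j : nc (y 0 j) <= w i * f (enum_val j).
  by rewrite -ler_pdivrMr//; exact: imax.
have yiE : nc (y 0 i) = w i * f (enum_val i) by rewrite mulfVK// gt_eqF.
have zle : nc z * nc (y 0 i) <= w i * nbsum f (enum_val i).
  rewrite nbsum_enum mulr_sumr -ComplexField.Normc.normcM -lecR rmorph_sum/=.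
  have -> : (nc (z * y 0 i))%:C%C = `|\sum_j y 0 j * adjmx R[i] G j i|.
    have -> : \sum_j y 0 j * adjmx R[i] G j i = z * y 0 i.
      by have /rowP/(_ i) := yz; rewrite !mxE.
    by [].
  apply: le_trans (ler_norm_sum _ _ _) _; apply: ler_sum => j _.
  rewrite normrM !mxE normr_nat mulrCA mulrC rmorphM/= rmorph_nat.
  by rewrite ler_wpM2l ?ler0n// -[`|_|]/(nc _)%:C%C lecR.
have : w i * (nc z * f (enum_val i)) < w i * (r * f (enum_val i)).
  rewrite mulrCA -yiE; apply: le_lt_trans zle _.
  by rewrite ltr_pM2l.
by rewrite ltr_pM2l// ltr_pM2r.
Qed.

Lemma spectral_radius_le (R : realType) (G : sgraph) (f : G -> R) (r : R) :
  (0 < #|G|)%N -> (forall x, 0 < f x) -> (forall x, nbsum f x <= r * f x) ->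
  spectral_radius R G <= r.
Proof.
move=> G0 f0 fr; rewrite leNgt; apply/negP => rho.
have := ltxx (spectral_radius R G); rewrite (spectral_radius_lt G0 f0)// => x.
by apply: le_lt_trans (fr x) _; rewrite ltr_pM2r.
Qed.

Lemma spectral_radius_ge (R : realType) (G : sgraph) (f : G -> R) (r : R) x0 :
  f x0 != 0 -> 0 <= r -> (forall x, nbsum f x = r * f x) ->
  r <= spectral_radius R G.
Proof.
move=> fx0 r0 fr; have G0 : (0 < #|G|)%N by apply/card_gt0P; exists x0.
have [_ ub] := spectral_radiusP R G0; apply: ub; exists (r%:C)%C; last first.
  by rewrite /= expr0n addr0 sqrtr_sqr ger0_norm.
apply/eigenvalueP; exists (\row_i (f (enum_val i))%:C%C).
  apply/rowP => i; rewrite !mxE -rmorphM -fr nbsum_enum rmorph_sum/=.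
  by apply: eq_bigr => j _; rewrite !mxE rmorphM/= rmorph_nat mulrC.
apply: contraNneq fx0 => /rowP/(_ (enum_rank x0)).
by rewrite !mxE enum_rankK => -[->].
Qed.

(** * Neighbour sums in joins, disjoint unions and complete graphs *)

Lemma nbsum_gunion_l (R : pzRingType) (G H : sgraph) (f : gunion G H -> R) x :
  nbsum f (inl x) = nbsum (fun y : G => f (inl y)) x.
Proof.
rewrite /nbsum big_sumType/= [X in _ + X]big1 ?addr0// => y _.
by rewrite mul0r.
Qed.

Lemma nbsum_gunion_r (R : pzRingType) (G H : sgraph) (f : gunion G H -> R) x :
  nbsum f (inr x) = nbsum (fun y : H => f (inr y)) x.
Proof.
rewrite /nbsum big_sumType/= [X in X + _]big1 ?add0r// => y _.
by rewrite mul0r.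
Qed.

Lemma nbsum_gjoin_l (R : pzRingType) (G H : sgraph) (f : gjoin G H -> R) x :
  nbsum f (inl x) = nbsum (fun y : G => f (inl y)) x + \sum_y f (inr y).
Proof.
rewrite /nbsum big_sumType/=; congr (_ + _).
by apply: eq_bigr => y _; rewrite mul1r.
Qed.

Lemma nbsum_gjoin_r (R : pzRingType) (G H : sgraph) (f : gjoin G H -> R) x :
  nbsum f (inr x) = \sum_y f (inl y) + nbsum (fun y : H => f (inr y)) x.
Proof.
rewrite /nbsum big_sumType/=; congr (_ + _).
by apply: eq_bigr => y _; rewrite mul1r.
Qed.

Lemma nbsum_complete (R : pzRingType) n (a : R) (i : complete n) :
  nbsum (fun _ => a) i = (n%:R - 1) * a.
Proof.
rewrite /nbsum (bigD1 i)//= eqxx mul0r add0r.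
rewrite (eq_bigr (fun=> a)) => [|j]; last first.
  by rewrite eq_sym => ->; rewrite mul1r.
rewrite sumr_const cardC1 card_ord; case: n i => [[]//|n] _ /=.
by rewrite -addn1 natrD addrK mulr_natl.
Qed.

Lemma nbsum_edgeless (R : pzRingType) n (f : edgeless n -> R) i :
  nbsum f i = 0.
Proof. by rewrite /nbsum big1// => j _; rewrite mul0r. Qed.

(** * The graph D with a distinguished apex *)

(** [Dgraph n e] for [n >= k + 2], with the number [m] of pendant vertices at
    the apex as parameter in place of [n]. *)
Definition Dgraph_ge (k t m : nat) : sgraph :=
  gjoin (gunion (gjoin (gunion (complete (k - t)) (complete 1)) (complete t))
                (edgeless m))
        (complete 1).

(** The weight [a] goes to the clique on [k - t] vertices, [c] to the clique on
    [t] vertices, [u] to the vertex joined to the latter, [s] to the pendant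
    vertices and [v] to the apex. *)
Definition Dfun (R : Type) (k t m : nat) (a u c s v : R) :
    Dgraph_ge k t m -> R :=
  fun x => match x with
           | inl (inl (inl (inl _))) => a
           | inl (inl (inl (inr _))) => u
           | inl (inl (inr _)) => c
           | inl (inr _) => s
           | inr _ => v
           end.

Lemma nbsum_Dfun (R : comPzRingType) (k t m : nat) (a u c s v : R) x :
  (t <= k)%N ->
  nbsum (@Dfun R k t m a u c s v) x =
  @Dfun R k t m ((k%:R - t%:R - 1) * a + t%:R * c + v)
                (t%:R * c + v)
                ((k%:R - t%:R) * a + u + (t%:R - 1) * c + v)
                v
                ((k%:R - t%:R) * a + u + t%:R * c + m%:R * s) x.
Proof.
move=> tk; have sumc p (b : R) : \sum_(i : complete p) b = p%:R * b.
  by rewrite sumr_const card_ord mulr_natl.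
case: x => [[[[x|x]|x]|x]|x] /=.
- rewrite nbsum_gjoin_l nbsum_gunion_l nbsum_gjoin_l nbsum_gunion_l/=.
  by rewrite nbsum_complete !sumc natrB// mul1r.
- rewrite nbsum_gjoin_l nbsum_gunion_l nbsum_gjoin_l nbsum_gunion_r/=.
  by rewrite nbsum_complete !sumc subrr mul0r add0r mul1r.
- rewrite nbsum_gjoin_l nbsum_gunion_l nbsum_gjoin_r/=.
  by rewrite nbsum_complete big_sumType/= !sumc natrB// !mul1r.
- rewrite nbsum_gjoin_l nbsum_gunion_r nbsum_edgeless/=.
  by rewrite sumc add0r mul1r.
- rewrite nbsum_gjoin_r/= nbsum_complete subrr mul0r addr0.
  by rewrite !big_sumType/= !sumc natrB// mul1r.
Qed.

(** * Roots beyond a point of negative value *)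

(** The polynomial is given by its coefficients so that the positivity of the
    leading one needs no computation of degrees. *)
Lemma exists_root_gt (R : rcfType) (s : seq R) (a : R) :
  0 < last 0 s -> (Poly s).[a] < 0 -> exists2 x, a < x & (Poly s).[x] = 0.
Proof.
move=> s0 pa.
have lc : 0 < lead_coef (Poly s).
  by rewrite /lead_coef (@PolyK _ 0) ?gt_eqF// nth_last.
have [b pb] := poly_pinfty_gt_lc lc.
pose c := Num.max a b.
have pc : 0 < (Poly s).[c].
  by apply: lt_le_trans lc (pb _ _); rewrite le_max lexx orbT.
have [||x xac /rootP px] := @poly_ivtoo _ (Poly s) a c.
- by rewrite le_max lexx.
- by rewrite nmulr_rlt0.
by exists x => //; rewrite (itvP xac).
Qed.

(** * The sign of the defect and the spectral radius *)

Section Eigen.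
Variable R : realType.

(** Eliminating the other weights from the eigenvalue equations, for the apex
    weight 1, leaves a linear equation for the total weight; [apexw] is the
    coefficient in it.  Scaling the vector by [apexw] removes the
    denominators, except at the pendant vertices. *)
Definition apexw (k t x : R) : R := (x + 1 - k) * (x ^+ 2 + x - t) - t ^+ 2.

(** [x] times the amount by which the apex equation fails for the vector that
    solves all the others; see [nbsum_Dvec]. *)
Definition defect (k t m x : R) : R :=
  (x ^+ 2 + x - m) * apexw k t x
  - x * (x + 1) * (x ^+ 2 + 2 * x + 1 - k + t).

Lemma apexw_gt0 (k t x : R) : 0 <= t -> t + 1 <= k -> k <= x -> 0 < apexw k t x.
Proof.
move=> t0 tk kx; rewrite /apexw subr_gt0.
have h : t ^+ 2 < x ^+ 2 + x - t by nra.
by apply: lt_le_trans h _; rewrite ler_peMl; nra.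
Qed.

(** The apex weight [v] is kept free: [v = apexw k t x] gives the solution of
    the equations off the apex, and lowering [v] makes them strict
    inequalities. *)
Definition Dvec (k t m : nat) (x v : R) : Dgraph_ge k t m -> R :=
  Dfun (x * (x + 1)) ((x + 1) * (x + 1 - k%:R + t%:R))
       ((x + 1) ^+ 2 - k%:R + t%:R) (apexw k%:R t%:R x / x) v.

Lemma Dvec_gt0 (k t m : nat) (x v : R) y :
  (t < k)%N -> k%:R <= x -> 0 < v -> 0 < @Dvec k t m x v y.
Proof.
move=> tk kx v0; have t0 : 0 <= t%:R :> R by rewrite ler0n.
have tk1 : t%:R + 1 <= k%:R :> R by rewrite natr1 ler_nat.
have q0 := apexw_gt0 t0 tk1 kx.
rewrite /Dvec; case: y => [[[[y|y]|y]|y]|y] //=;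
  last by rewrite divr_gt0//; lra.
- by rewrite mulr_gt0//; lra.
- by rewrite mulr_gt0//; lra.
- nra.
Qed.

Lemma nbsum_Dvec (k t m : nat) (x v : R) y :
  (t < k)%N -> k%:R <= x ->
  let q := apexw k%:R t%:R x in
  nbsum (@Dvec k t m x v) y =
  if y is inr _ then x * q - defect k%:R t%:R m%:R x / x
  else x * @Dvec k t m x v y - (q - v).
Proof.
move=> tk kx q; have x0 : x != 0.
  have : 1 <= k%:R :> R by rewrite ler1n (leq_ltn_trans _ tk).
  by move=> k1; rewrite gt_eqF//; lra.
rewrite /Dvec nbsum_Dfun ?(ltnW tk)// /q /defect /apexw.
by case: y => [[[[y|y]|y]|y]|y] /=; field.
Qed.

(** There is slack at the apex only.  Lowering the apex weight by half of that
    slack creates slack at every other vertex and keeps some at the apex. *)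
Lemma spectral_radius_defect_gt0 (k t m : nat) (x : R) :
  (t < k)%N -> k%:R <= x -> 0 < defect k%:R t%:R m%:R x ->
  spectral_radius R (Dgraph_ge k t m) < x.
Proof.
move=> tk kx P0; have t0 : 0 <= t%:R :> R by rewrite ler0n.
have m0 : 0 <= m%:R :> R by rewrite ler0n.
have tk1 : t%:R + 1 <= k%:R :> R by rewrite natr1 ler_nat.
have q0 := apexw_gt0 t0 tk1 kx; have x0 : 0 < x by lra.
set q := apexw _ _ _ in q0; set P := defect _ _ _ _ in P0.
(* [x ^+ 2 * q - P] is [x] times the neighbour sum at the apex. *)
have Pq : P < x ^+ 2 * q.
  rewrite -subr_gt0 /P /defect -/q.
  set h := x ^+ 2 + 2 * x + 1 - k%:R + t%:R.
  have -> : x ^+ 2 * q - ((x ^+ 2 + x - m%:R) * q - x * (x + 1) * h)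
    = m%:R * q + x * ((x + 1) * h - q) by ring.
  rewrite ltr_wpDl ?mulr_ge0 ?(ltW q0)// mulr_gt0//.
  have -> : (x + 1) * h - q
      = k%:R * (x ^+ 2 + x) + (x + 1 + t%:R) * (x + 1 - k%:R + t%:R).
    by rewrite /q /apexw /h; ring.
  by rewrite ltr_wpDl ?mulr_ge0 ?mulr_gt0//; nra.
pose v := q - P / (2 * x ^+ 2).
have x20 : 0 < 2 * x ^+ 2 by nra.
have vq : v < q by rewrite /v ltrBlDr ltrDl divr_gt0.
have v0 : 0 < v.
  by rewrite /v subr_gt0 ltr_pdivrMr//; nra.
apply: (@spectral_radius_lt _ _ (@Dvec k t m x v)).
- by apply/card_gt0P; exists (inr ord0).
- by move=> y; exact: Dvec_gt0.
move=> y; rewrite nbsum_Dvec// -/q -/P.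
case: y => [y|y]; first by rewrite ltrBlDr ltrDl subr_gt0.
rewrite /Dvec /= /v (mulrBr x q) ltrD2l ltrN2.
have -> : x * (P / (2 * x ^+ 2)) = P / x / 2 by field; rewrite gt_eqF.
have : 0 < P / x by rewrite divr_gt0.
by move=> ?; lra.
Qed.

Lemma spectral_radius_defect_eq0 (k t m : nat) (x : R) :
  (t < k)%N -> k%:R <= x -> defect k%:R t%:R m%:R x = 0 ->
  spectral_radius R (Dgraph_ge k t m) = x.
Proof.
move=> tk kx P0; have t0 : 0 <= t%:R :> R by rewrite ler0n.
have tk1 : t%:R + 1 <= k%:R :> R by rewrite natr1 ler_nat.
have q0 := apexw_gt0 t0 tk1 kx; have x0 : 0 < x by lra.
pose f := @Dvec k t m x (apexw k%:R t%:R x).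
have f0 y : 0 < f y by exact: Dvec_gt0.
have fE y : nbsum f y = x * f y.
  rewrite nbsum_Dvec// P0 mul0r subr0 subrr subr0.
  by case: y.
apply/le_anti/andP; split.
  apply: (@spectral_radius_le _ _ f) => [|//|y]; last by rewrite fE.
  by apply/card_gt0P; exists (inr ord0).
apply: (@spectral_radius_ge _ _ f x (inr ord0)) => //; last exact: ltW.
by rewrite gt_eqF.
Qed.

(** The defect is a monic quintic in [x], so it vanishes somewhere beyond a point
    where it is negative, and such a zero is the spectral radius. *)
Lemma spectral_radius_defect_lt0 (k t m : nat) (x : R) :
  (t < k)%N -> k%:R <= x -> defect k%:R t%:R m%:R x < 0 ->
  x < spectral_radius R (Dgraph_ge k t m).
Proof.
move=> tk kx P0; pose K : R := k%:R; pose T : R := t%:R; pose M : R := m%:R.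
(* The coefficients of [apexw], from which those of the defect follow. *)
pose q0 := T * (K - 1 - T); pose q1 := 1 - K - T; pose q2 := 2 - K.
pose s := [:: - M * q0; q0 - M * q1 - (1 - K + T);
  q0 + q1 - M * q2 - (3 - K + T); q1 + q2 - M - 3; q2; 1].
have sE y : (Poly s).[y] = defect K T M y.
  by rewrite horner_Poly /= /defect /apexw /q0 /q1 /q2; ring.
have [||z xz] := @exists_root_gt _ s x; first exact: ltr01.
  by rewrite sE.
rewrite sE => zE; rewrite (spectral_radius_defect_eq0 tk _ zE)//.
exact: le_trans kx (ltW xz).
Qed.

End Eigen.

(** * The polynomial Psi *)

(** The disjunction excludes [k = 3] with [t = 0], where the leading coefficient
    of [Psi] would vanish. *)
Lemma k_t_spec (e : nat) : (4 <= e)%N ->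
  [/\ (3 <= k_ e)%N, (t_ e < k_ e)%N, (3 < k_ e)%N || (0 < t_ e)%N
    & (2 * e = k_ e * (k_ e).-1 + 2 * t_ e)%N].
Proof.
rewrite /t_ /k_; case: ex_maxnP => k ke kmax e4.
have k3 : (3 <= k)%N by apply: kmax; exact: leq_trans e4.
(* The maximality of [k] gives [t < k]. *)
have eS : (e < 'C(k.+1, 2))%N.
  by rewrite ltnNge; apply/negP => /kmax; rewrite ltnn.
have bin2M : (2 * 'C(k, 2) = k * k.-1)%N by rewrite -mul_bin_diag bin1 mulnC.
rewrite binS bin1 in eS.
split=> //; [lia | | lia].
rewrite subn_gt0; move: k3; rewrite leq_eqVlt => /orP[/eqP<-|->//].
by rewrite e4 orbT.
Qed.

(** This is the sign of the factor of [Psi] that is left at [x0].  Since [k] and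
    [x] determine [e] and [t], the left-hand side is a polynomial in
    [j = k - 3] and [s = x - k].  Its coefficients as a polynomial in [j] are
    polynomials in [s] that are negative for [0 <= s]. *)
Lemma star_defect_lt0 (R : realType) (k t e x : R) : 3 <= k -> k <= x ->
  2 * e = k ^+ 2 - k + 2 * t -> x ^+ 2 - x = 2 * e ->
  defect k t 0 x - (e - k) * apexw k t x < 0.
Proof.
have [j ->] : exists j, k = 3 + j by exists (k - 3); ring.
have [s ->] : exists s, x = 3 + j + s by exists (x - 3 - j); ring.
rewrite !lerDl => j0 s0 et xe.
have eE : e = ((3 + j + s) ^+ 2 - (3 + j + s)) / 2 by lra.
have tE : t = (2 * e - (3 + j) ^+ 2 + (3 + j)) / 2 by lra.
rewrite {et xe}tE {}eE.
rewrite -(@pmulr_rlt0 _ 8)// -oppr_gt0.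
set p := (X in 0 < X); have {p}-> : p =
  j ^+ 4 * (4 - 4 * s + 4 * s ^+ 2)
  + j ^+ 3 * (40 - 44 * s + 52 * s ^+ 2 + 12 * s ^+ 3)
  + j ^+ 2 * (140 - 186 * s + 241 * s ^+ 2 + 116 * s ^+ 3 + 13 * s ^+ 4)
  + j * (200 - 366 * s + 467 * s ^+ 2 + 354 * s ^+ 3 + 79 * s ^+ 4
         + 6 * s ^+ 5)
  + (96 - 280 * s + 314 * s ^+ 2 + 339 * s ^+ 3 + 113 * s ^+ 4 + 17 * s ^+ 5
     + s ^+ 6).
  by rewrite /p /defect /apexw; field.
have sn n : 0 <= s ^+ n by rewrite exprn_ge0.
(* In each coefficient the quadratic part has negative discriminant. *)
have [[[s3 s4] s5] s6] := (sn 3, sn 4, sn 5, sn 6).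
rewrite ltr_wpDl//; last by nra.
rewrite !addr_ge0 ?mulr_ge0 ?exprn_ge0//; nra.
Qed.

Section Psi.
Variables (R : realType) (e : nat).
Hypothesis e4 : (4 <= e)%N.
Let k : R := (k_ e)%:R.
Let t : R := (t_ e)%:R.

Lemma k_t_real :
  [/\ 3 <= k, 0 <= t, t + 1 <= k, 4 <= k \/ 1 <= t
    & 2 * e%:R = k ^+ 2 - k + 2 * t].
Proof.
have [k3 tk kt eE] := k_t_spec e4; rewrite /k /t; split.
- by rewrite ler_nat.
- by rewrite ler0n.
- by rewrite natr1 ler_nat.
- by case/orP: kt => [?|?]; [left | right]; rewrite ?ler_nat ?ler1n.
move: (k_ e) (t_ e) k3 eE => [//|i] j _ eE.
by rewrite -natrM eE /= natrD !natrM -[i.+1]addn1 natrD; ring.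
Qed.

(** The equation that defines [Psi]: the apex equation of D and that of the
    quasi-star give the same number of vertices.  The terms in [m] cancel. *)
Lemma Psi_defect (x m : R) : 4 * ((x ^+ 2 - e%:R) * (defect k t m x
    - (e%:R - k - m) * apexw k t x)
    - x * (x + 1) * (x ^+ 2 - x - 2 * e%:R) * apexw k t x) = (Psi R e).[x].
Proof.
have [_ _ _ _ eE] := k_t_real.
have -> : e%:R = (k ^+ 2 - k + 2 * t) / 2 :> R by lra.
rewrite /Psi -/k -/t !(hornerD, hornerN, hornerZ, hornerXn, hornerX, hornerC).
by rewrite /defect /apexw; field.
Qed.

(** Here the last term of [Psi_defect] drops out, and the parameters satisfy
    the relations of [star_defect_lt0]. *)
Lemma Psi_lt0 (x : R) : 0 <= x -> x ^+ 2 - x = 2 * e%:R -> (Psi R e).[x] < 0.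
Proof.
have [k3 t0 tk _ eE] := k_t_real; move=> x0 xe.
have kx : k <= x by nra.
rewrite -(Psi_defect x 0) xe subrr mulr0 mul0r subr0 pmulr_rlt0//.
have De : 0 < x ^+ 2 - e%:R by nra.
rewrite pmulr_rlt0//.
by rewrite subr0; exact: star_defect_lt0.
Qed.

Lemma psi_gt : exists2 x, k <= x /\ x ^+ 2 - x = 2 * e%:R & x < psi R e.
Proof.
have [k3 t0 tk kt eE] := k_t_real.
pose r := Num.sqrt (1 + 8 * e%:R : R); pose x := (1 + r) / 2.
have r0 : 0 <= r by rewrite sqrtr_ge0.
have r2 : r ^+ 2 = 1 + 8 * e%:R by rewrite sqr_sqrtr// addr_ge0// mulr_ge0.
have xe : x ^+ 2 - x = 2 * e%:R.
  have -> : x ^+ 2 - x = (r ^+ 2 - 1) / 4 by rewrite /x; field.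
  by rewrite r2; field.
have x0 : 0 <= x by rewrite /x; lra.
exists x; first by split=> //; nra.
pose c3 := (k - 1) * (k - 2) * (k ^+ 2 - 3 * k + 4 * t).
(* Only the leading coefficient has to be made explicit. *)
pose s := [:: (Psi R e)`_0; (Psi R e)`_1; (Psi R e)`_2; c3].
have sE y : (Poly s).[y] = (Psi R e).[y].
  rewrite horner_Poly /= /Psi -/k -/t -/c3.
  rewrite !(hornerD, hornerN, hornerZ, hornerXn, hornerX, hornerC).
  rewrite !(coefD, coefN, coefZ, coefXn, coefX, coefC)/=.
  by clear s; move: c3 => c3; ring.
have [||z xz] := @exists_root_gt _ s x.
- by rewrite /= !mulr_gt0//; [lra | lra | case: kt => ?; nra].
- by rewrite sE Psi_lt0.
rewrite sE => /rootP zr; apply: lt_le_trans xz _.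
by have [_] := @psiP R e e4; apply.
Qed.

Lemma psi_bounds :
  [/\ k < psi R e, 0 < (psi R e) ^+ 2 - e%:R
    & 0 < (psi R e) ^+ 2 - psi R e - 2 * e%:R].
Proof.
have [k3 t0 tk _ eE] := k_t_real; have [x [kx xe] xp] := psi_gt.
by split; nra.
Qed.

(** * The comparison at psi *)

Lemma omega_gt : (e + 2)%:R < omega R e.
Proof.
have [k3 _ _ _ _] := k_t_real; have [kp p1 p2] := psi_bounds.
rewrite /omega natrD ltrDl divr_gt0// !mulr_gt0//; lra.
Qed.

Lemma defect_omega n : defect k t (n%:R - k - 2) (psi R e) =
  apexw k t (psi R e) * (omega R e - n%:R).
Proof.
have [_ p1 _] := psi_bounds; have [/rootP pr _] := @psiP R e e4.
have := Psi_defect (psi R e) (n%:R - k - 2); rewrite pr.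
move: (defect _ _ _ _) (apexw _ _ _) => d q.
rewrite /omega; move: (psi R e) p1 => p p1 h.
have D0 : p ^+ 2 - e%:R != 0 by rewrite gt_eqF.
apply: (mulIf D0); apply/eqP; rewrite -subr_eq0; apply/eqP.
transitivity (4 * ((p ^+ 2 - e%:R) * (d - (e%:R - k - (n%:R - k - 2)) * q)
    - p * (p + 1) * (p ^+ 2 - p - 2 * e%:R) * q) / 4).
  by field.
by rewrite h mul0r.
Qed.

End Psi.

Lemma spectral_radius_complete_le (R : realType) n :
  (0 < n)%N -> spectral_radius R (complete n) <= n%:R - 1.
Proof.
move=> n0; apply: (@spectral_radius_le _ _ (fun=> 1)) => //.
  by rewrite card_ord.
by move=> x; rewrite nbsum_complete.
Qed.

Theorem proposition4p2 (R : realType) (e : nat) (he : (4 <= e)%N) :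
  (e + 2)%:R < omega R e /\
  forall n : nat, (b_ e <= n)%N ->
    [/\ n%:R < omega R e -> spectral_radius R (Dgraph n e) < psi R e,
        n%:R = omega R e -> spectral_radius R (Dgraph n e) = psi R e
      & n%:R > omega R e -> spectral_radius R (Dgraph n e) > psi R e].
Proof.
have om := omega_gt R he; split=> // n bn.
have [kp _ _] := psi_bounds R he.
have [k3 tk _ eE] := k_t_spec he.
have [_ t0 tk1 _ _] := k_t_real R he.
(* [n < k + 2] happens only for [t = 0] and [n = k + 1], when D is complete
   and its spectral radius [k] is less than [psi]. *)
have [kn|nk] := leqP (k_ e + 2)%N n; last first.
  have nE : n = (k_ e).+1.
    by move: bn nk; rewrite /b_; case: eqP => _; lia.
  have -> : Dgraph n e = complete n by rewrite /Dgraph leqNgt nk.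
  have no : n%:R < omega R e by apply: le_lt_trans om; rewrite ler_nat; nia.
  split=> [_||] ; last 2 first.
  - by move=> no'; rewrite no' ltxx in no.
  - by move=> /(lt_trans no); rewrite ltxx.
  have n0 : (0 < n)%N by rewrite nE.
  apply: le_lt_trans (spectral_radius_complete_le R n0) _.
  by rewrite nE -natr1 addrK.
have -> : Dgraph n e = Dgraph_ge (k_ e) (t_ e) (n - k_ e - 2).
  by rewrite /Dgraph kn.
have q0 := apexw_gt0 t0 tk1 (ltW kp).
have dE := defect_omega R he n.
have mE : (n - k_ e - 2)%N%:R = n%:R - (k_ e)%:R - 2 :> R.
  by rewrite -subnDA (natrB _ kn) natrD opprD addrA.
rewrite -mE in dE; split=> no.
- apply: spectral_radius_defect_gt0 (ltW kp) _; first by [].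
  by rewrite dE pmulr_rgt0// subr_gt0.
- apply: spectral_radius_defect_eq0 (ltW kp) _; first by [].
  by rewrite dE no subrr mulr0.
- apply: spectral_radius_defect_lt0 (ltW kp) _; first by [].
  by rewrite dE pmulr_rlt0// subr_lt0.
Qed.
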